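(* Let $\zeta\ge 1$, let $X_1,\dots,X_{\zeta+1}$ be operators each decomposed, for $p=1,\dots,\zeta+1$, as $$X_p=\int_{\lambda_p\in\sigma(X_p)}\lambda_p\,dE_{X_p}(\lambda_p)+\int_{\lambda_p\in\sigma(X_p)}(X_p-\lambda_pI)\,dE_{X_p}(\lambda_p)=:X_{p,P}+X_{p,N},$$ let $Y_1,\dots,Y_\zeta$ be operators, and let $\beta$ be a function of $\zeta+1$ variables for which the generalized multiple operator integral (GMOI) $T_\beta^{X_1,\dots,X_{\zeta+1}}(Y_1,\dots,Y_\zeta)$ is defined. Then $$T_{\beta}^{X_1,\ldots,X_{\zeta+1}}(Y_1,\ldots,Y_{\zeta})=\sum_{i=1}^{2^{\zeta+1}}T_{\beta}^{[X]_{\xi(i)}}(Y_1,\ldots,Y_{\zeta}),$$ where $[X]_{\xi(i)}$ is the array with $\zeta+1$ entries whose $j$-th entry is $X_{j,P}$ if $\left\lfloor \frac{i-1}{2^{j-1}}\right\rfloor\equiv 0 \pmod 2$, and $X_{j,N}$ otherwise.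
   Context: Operators act on a Hilbert space; $I$ is the identity. $E_X$ denotes the spectral measure of $X$, with $\int_{\sigma(X)}dE_X(\lambda)=I$; operators need not be normal or self-adjoint. For each $\lambda\in\sigma(X)$, $(X-\lambda I)dE_X(\lambda)$ is nilpotent of order $m_\lambda$: $(X-\lambda I)^{\ell}dE_X(\lambda)=0$ for $\ell\ge m_\lambda$. GMOI: for a (sufficiently differentiable) function $\beta$ of $\zeta+1$ variables, put $Y_{\zeta+1}:=I$ and define $$T_\beta^{X_1,\dots,X_{\zeta+1}}(Y_1,\dots,Y_\zeta):=\int_{\sigma(X_1)}\cdots\int_{\sigma(X_{\zeta+1})}\ \sum_{K\subseteq\{1,\dots,\zeta+1\}}\ \sum_{\substack{1\le q_k\le m_{\lambda_k}-1\\ k\in K}}\frac{\big(\prod_{k\in K}\partial_{\lambda_k}^{q_k}\big)\beta(\lambda_1,\dots,\lambda_{\zeta+1})}{\prod_{k\in K}q_k!}\ Z_1Y_1Z_2Y_2\cdots Z_{\zeta+1}Y_{\zeta+1},$$ where $Z_p=(X_p-\lambda_pI)^{q_p}dE_{X_p}(\lambda_p)$ if $p\in K$ and $Z_p=dE_{X_p}(\lambda_p)$ if $p\notin K$. Convention: when a parameter operator in the superscript of $T_\beta$ is written $X_{p,P}$ (resp. $X_{p,N}$) in place of $X_p$, this denotes the part of the sum over subsets $K\subseteq\{1,\dots,\zeta+1\}$ in the defining formula of the GMOI $T_\beta^{X_1,\dots,X_{\zeta+1}}(Y_1,\dots,Y_\zeta)$ restricted to $p\notin K$ (only the factor $dE_{X_p}(\lambda_p)$)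 (resp. to $p\in K$ (only the factors $(X_p-\lambda_pI)^{q_p}dE_{X_p}(\lambda_p)$, $q_p\ge1$)). *)

(* Defs.v *)
From HB Require Import structures.
From mathcomp Require Import all_boot all_order all_algebra.
From mathcomp Require Import all_classical all_reals all_analysis.
From mathcomp Require Import complex.

Set Implicit Arguments.
Unset Strict Implicit.
Unset Printing Implicit Defensive.

Import Order.TTheory GRing.Theory Num.Theory.
Import numFieldNormedType.Exports.

Local Open Scope classical_set_scope.
Local Open Scope ring_scope.

(* The topology given by the modulus is found on the alias R[i]^o only. *)
Notation Cplx R := (R[i]^o).

Definition hilbert_norm (R : realType) (H : completeNormedModType R[i])
    (dot : {dot H for Num.conj}) : Prop :=
  forall v : H, `|v| ^+ 2 = dot v v.

Section Operators.
Variables (R : realType) (H : completeNormedModType R[i]).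
Local Notation C := (Cplx R).

Record operator := Operator {
  op_fun :> {linear H -> H};
  op_continuous : continuous op_fun }.

Definition sub_scalar (X : operator) (l : C) : H -> H := fun v => X v - l *: v.

Definition spectrum (X : operator) : set C :=
  [set l | ~ exists B : operator,
      cancel (sub_scalar X l) B /\ cancel B (sub_scalar X l)].

(* Borel subsets of the subspace D. *)
Definition borel (D : set C) : set (set C) :=
  <<s D, [set U `&` D | U in (open : set (set C))]>>.

End Operators.

(* Integrals against operator-valued measures are limits, in the strong
   operator topology, of Riemann sums over finite tagged Borel partitions
   directed by refinement, the tags being arbitrary. *)
Section Partitions.
Variables (R : realType).
Local Notation C := (Cplx R).

Record tpart (D : set C) := TPart {
  ncell : nat;
  cell : 'I_ncell -> set C;
  node : 'I_ncell -> C;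
  cell_borel : forall j, borel D (cell j);
  cell_disj : trivIset setT cell;
  cell_cover : \bigcup_j cell j = D;
  node_cell : forall j, cell j (node j) }.

Definition refines (D : set C) (pi1 pi0 : tpart D) : Prop :=
  forall j, exists k, cell (t := pi1) j `<=` cell (t := pi0) k.

Definition refinement (D : set C) : set_system (tpart D) :=
  [set Q | exists pi0, [set pi1 | refines pi1 pi0] `<=` Q].

Definition multi_refinement (I : Type) (D : I -> set C) :
    set_system (forall p, tpart (D p)) :=
  [set Q | exists pi0 : forall p, tpart (D p),
     [set pi1 | forall p, refines (pi1 p) (pi0 p)] `<=` Q].

End Partitions.
Arguments refinement {R} D.
Arguments multi_refinement {R I} D.

Section SpectralOperators.
Variables (R : realType) (H : completeNormedModType R[i]).
Local Notation C := (Cplx R).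

(* T = \int_D F(l) dE(l) *)
Definition is_opint (E : set C -> operator H) (D : set C)
    (F : C -> H -> H) (T : H -> H) : Prop :=
  forall v, (fun pi : tpart D =>
      \sum_(j < ncell pi) F (node j) (E (cell j) v))
    @ refinement D --> T v.

(* The projections E A need not be self-adjoint. *)
Record is_spectral_measure (X : operator H) (E : set C -> operator H) : Prop :=
  IsSpectralMeasure {
    spm_total : forall v, E (spectrum X) v = v;
    spm_mul : forall A B, borel (spectrum X) A -> borel (spectrum X) B ->
      forall v, E A (E B v) = E (A `&` B) v;
    spm_sigma_additive : forall A : nat -> set C,
      (forall k, borel (spectrum X) (A k)) -> trivIset setT A ->
      forall v, series (fun k => E (A k) v) @ \oo --> E (\bigcup_k A k) v;
    spm_comm : forall A, borel (spectrum X) A ->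
      forall v, X (E A v) = E A (X v) }.

(* (X - l)^k dE(l) = 0 for k >= m l, as an identity between measures. *)
Definition nilpotent_order (X : operator H) (E : set C -> operator H)
    (m : C -> nat) : Prop :=
  (forall k, borel (spectrum X) (spectrum X `&` [set l | m l <= k]%N)) /\
  (forall k A, borel (spectrum X) A -> A `<=` [set l | m l <= k]%N ->
     is_opint E A (fun l => iter k (sub_scalar X l)) (fun=> 0)).

Record decomposed_op := DecomposedOp {
  dop_op :> operator H;
  dop_E : set C -> operator H;
  dop_m : C -> nat;
  dop_P : operator H;
  dop_N : operator H;
  dop_spectral : is_spectral_measure dop_op dop_E;
  dop_nilpotent : nilpotent_order dop_op dop_E dop_m;
  dop_PE : is_opint dop_E (spectrum dop_op) (fun l v => l *: v) dop_P;
  dop_NE : is_opint dop_E (spectrum dop_op) (sub_scalar dop_op) dop_N;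
  dop_decomp : forall v, dop_op v = dop_P v + dop_N v }.

(* The possible entries X_p, X_{p,P}, X_{p,N} of the superscript of T_beta. *)
Inductive entry :=
  | Whole of decomposed_op
  | PartP of decomposed_op
  | PartN of decomposed_op.

Definition entry_op (e : entry) : decomposed_op :=
  match e with Whole X | PartP X | PartN X => X end.

(* For inK the truth value of "p is in K". *)
Definition entry_allows (e : entry) (inK : bool) : bool :=
  match e with Whole _ => true | PartP _ => ~~ inK | PartN _ => inK end.

End SpectralOperators.

Section MixedPartials.
Variables (R : realType) (n : nat).
Local Notation C := (Cplx R).
Implicit Type beta : 'rV[C]_n.+1 -> C.

Definition partial_derivative (k : 'I_n.+1) beta : 'rV[C]_n.+1 -> C :=
  fun x => 'D_(delta_mx 0 k) beta x.

Definition mixed_partial (s : seq 'I_n.+1) beta : 'rV[C]_n.+1 -> C :=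
  foldr partial_derivative beta s.

Fixpoint mixed_derivable (s : seq 'I_n.+1) beta (x : 'rV[C]_n.+1) : Prop :=
  if s is k :: s' then
    (\forall y \near x, mixed_derivable s' beta y) /\
    derivable (mixed_partial s' beta) x (delta_mx 0 k)
  else True.

End MixedPartials.

Section GMOI.
Variables (R : realType) (H : completeNormedModType R[i]) (zeta : nat).
Local Notation C := (Cplx R).
Variable beta : 'rV[C]_zeta.+1 -> C.
Implicit Types (X : 'I_zeta.+1 -> decomposed_op H) (Y : 'I_zeta -> operator H).

(* Y_1, ..., Y_zeta, I *)
Definition extendY Y (p : 'I_zeta.+1) : H -> H :=
  if unlift ord_max p is Some j then Y j else idfun.

(* Z_1 Y_1 ... Z_(zeta+1) Y_(zeta+1), with A p standing for dE_(X_p)(l_p). *)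
Definition word X Y (l : 'rV[C]_zeta.+1) (A : 'I_zeta.+1 -> operator H)
    (K : {set 'I_zeta.+1}) (q : 'I_zeta.+1 -> nat) : H -> H :=
  \big[(fun f g : H -> H => f \o g)/idfun]_(p < zeta.+1)
    ((if p \in K then iter (q p) (sub_scalar (X p) (l ord0 p)) \o A p else A p)
      \o extendY Y p).

(* The exponents (q_k), k in K, are encoded as the families q on all indices
   with q_p <= m_p - 1 and q_p = 0 exactly when p is not in K. *)
Definition integrand (P : pred {set 'I_zeta.+1}) X Y
    (l : 'rV[C]_zeta.+1) (A : 'I_zeta.+1 -> operator H) (v : H) : H :=
  \sum_(K : {set 'I_zeta.+1} | P K)
   \sum_(q : {dffun forall p : 'I_zeta.+1, 'I_(dop_m (X p) (l ord0 p)).-1.+1}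
         | [forall p, (p \in K) == (0 < q p)%N])
     (mixed_partial (flatten [seq nseq (q k) k | k <- enum K]) beta l
        / \prod_(k in K) (q k)`!%:R)
     *: word X Y l A K (fun p => q p) v.

Definition riemann_sum (P : pred {set 'I_zeta.+1}) X Y
    (pi : forall p, tpart (spectrum (X p))) (v : H) : H :=
  \sum_(j : {dffun forall p : 'I_zeta.+1, 'I_(ncell (pi p))})
    integrand P X Y (\row_p node (j p)) (fun p => dop_E (X p) (cell (j p))) v.

(* The part of the integral coming from the subsets K satisfying P. *)
Definition is_gmoi_part (P : pred {set 'I_zeta.+1}) X Y (T : H -> H) : Prop :=
  forall v, (fun pi => riemann_sum P Y pi v)
    @ multi_refinement (fun p => spectrum (X p)) --> T v.

Definition sufficiently_differentiable X : Prop :=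
  forall (l : 'rV[C]_zeta.+1) (s : seq 'I_zeta.+1),
    (forall p, spectrum (X p) (l ord0 p)) ->
    (forall k, count_mem k s <= (dop_m (X k) (l ord0 k)).-1)%N ->
    mixed_derivable s beta l.

(* Every term, indexed by K, of the defining formula is a convergent integral;
   convergence of their sum alone would not give a meaning to the terms. *)
Definition gmoi_defined X Y : Prop :=
  sufficiently_differentiable X /\
  forall K, exists T : operator H, is_gmoi_part (pred1 K) X Y T.

(* T_beta^(e_1, ..., e_(zeta+1)) (Y_1, ..., Y_zeta) *)
Definition gmoi (e : 'I_zeta.+1 -> entry H) Y : H -> H := fun v =>
  lim ((fun pi => riemann_sum
          (fun K => [forall p, entry_allows (e p) (p \in K)]) Y pi v)
    @ multi_refinement (fun p => spectrum (entry_op (e p)))).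

End GMOI.

(* [X]_xi(i), for 1 <= i <= 2 ^ zeta.+1.  The ordinal j is 0-based, so that the
   exponent j - 1 of the 1-based convention is j here. *)
Definition xi_array (R : realType) (H : completeNormedModType R[i]) (zeta : nat)
    (X : 'I_zeta.+1 -> decomposed_op H) (i : nat) (j : 'I_zeta.+1) : entry H :=
  if odd ((i - 1) %/ 2 ^ j) then PartN (X j) else PartP (X j).

(* Main.v *)
(* The entries of the array [X]_xi(i) prescribe, for each p, whether p lies in
   K, so its integral keeps the single subset K whose indicator function is the
   binary expansion of i - 1.  As i runs through 1, ..., 2^(zeta+1), every subset
   occurs exactly once.  The integral of the sum over K is the sum of the
   integrals because two tagged partitions have a common refinement, i.e.
   refinement yields a proper filter, along which limits are unique and
   additive. *)
Require Import Defs.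
From HB Require Import structures.
From mathcomp Require Import all_boot all_order all_algebra.
From mathcomp Require Import all_classical all_reals all_analysis.
From mathcomp Require Import complex.

Set Implicit Arguments.
Unset Strict Implicit.
Unset Printing Implicit Defensive.

Import Order.TTheory GRing.Theory Num.Theory.
Import numFieldNormedType.Exports.

Local Open Scope classical_set_scope.
Local Open Scope ring_scope.

Section Partitions.
Variable R : realType.
Local Notation C := (Cplx R).
Implicit Types D A B : set C.

Lemma borel_sub D A : borel D A -> A `<=` D.
Proof.
suff: borel D `<=` [set A | A `<=` D] by apply.
apply: smallest_sub; last by move=> _ [U _ <-]; apply: subIsetr.
split=> [|B _|F FD]; [exact: sub0set | exact: subDsetl |].
by apply: bigcup_sub => n _; apply: FD.
Qed.

Lemma borelI D A B : borel D A -> borel D B -> borel D (A `&` B).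
Proof.
(* Closure under intersection is available for a sigma-algebra whose members all lie in [D], which
   [borel_sub] ensures. *)
have [+ _] := sigma_algebraP (@borel_sub D).
by case/(_ (smallest_sigma_algebra _ _)) => _ _ _; apply.
Qed.

Lemma borelT D : borel D D.
Proof. by rewrite -{2}[D]setD0; apply: sigma_algebraCD; apply: sigma_algebra0. Qed.

(* Cells of a tagged partition carry a tag, hence are nonempty: the empty
   members of the family have to be discarded. *)
Lemma tpart_of_family D (I : finType) (A : I -> set C) :
    (forall i, borel D (A i)) -> trivIset setT A -> \bigcup_i A i = D ->
  exists t : tpart D, forall j, exists i, cell (t := t) j `<=` A i.
Proof.
move=> bA tA cA.
pose J : finType := {i | `[< A i !=set0 >]}.
have neA (i : J) : exists x, A (val i) x by apply/asboolP/(valP i).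
pose c (j : 'I_#|J|) := A (val (enum_val j)).
have bc j : borel D (c j) by apply: bA.
have tc : trivIset setT c.
  by move=> j k _ _ /tA jk; apply/enum_val_inj/val_inj/jk.
have cc : \bigcup_j c j = D.
  rewrite -cA; apply/seteqP; split=> x [].
    by move=> j _ cx; exists (val (enum_val j)).
  move=> i _ Aix; have ne : `[< A i !=set0 >] by apply/asboolP; exists x.
  by exists (enum_rank (Sub i ne : J)) => //; rewrite /c enum_rankK.
exists (TPart bc tc cc (fun j => projT2 (cid (neA (enum_val j))))) => j.
by exists (val (enum_val j)).
Qed.

Lemma tpart_inhabited D : exists t : tpart D, True.
Proof.
have [||| t _] := @tpart_of_family D unit (fun=> D); last by exists t.
- by move=> _; apply: borelT.
- by move=> [] [].
- by rewrite bigcup_const //; exists tt.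
Qed.

Lemma common_refinement D (t1 t2 : tpart D) :
  exists t, refines t t1 /\ refines t t2.
Proof.
pose A (i : 'I_(ncell t1) * 'I_(ncell t2)) := cell i.1 `&` cell i.2.
have [|||t tA] := @tpart_of_family D _ A.
- by move=> i; apply: borelI; apply: cell_borel.
- move=> [i1 i2] [k1 k2] _ _ [x [[/= x1 x2] [/= y1 y2]]].
  by congr pair; apply: cell_disj => //; exists x.
- apply/seteqP; split=> [x [i _ [xi _]]|x Dx].
    by rewrite -(cell_cover t1); exists i.1.
  have: (\bigcup_j cell (t := t2) j) x by rewrite cell_cover.
  have: (\bigcup_j cell (t := t1) j) x by rewrite cell_cover.
  by move=> [i _ xi] [k _ xk]; exists (i, k).
by exists t; split=> j; have [i ti] := tA j; [exists i.1 | exists i.2] => x /ti[].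
Qed.

Lemma refines_trans D (t1 t2 t3 : tpart D) :
  refines t1 t2 -> refines t2 t3 -> refines t1 t3.
Proof.
move=> r12 r23 i; have [j ij] := r12 i; have [k jk] := r23 j.
by exists k; apply: subset_trans jk.
Qed.

Lemma multi_refinement_filter (I : Type) (D : I -> set C) :
  ProperFilter (multi_refinement D).
Proof.
pose t0 p := projT1 (cid (tpart_inhabited (D p))).
split; last split.
(* Every partition refines itself, so no member of the filter is empty. *)
- by case=> t /(_ t); apply=> p j; exists j.
- by exists t0.
- move=> P Q [t1 P1] [t2 Q2].
  pose t p := cid (common_refinement (t1 p) (t2 p)).
  exists (fun p => projT1 (t p)) => u ut; split; [apply: P1 | apply: Q2] => p;
    by apply: refines_trans (ut p) _; have [] := projT2 (t p).
- by move=> P Q PQ [t tP]; exists t; apply: subset_trans PQ.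
Qed.

End Partitions.

(** Induction on [n]: halving shifts the digits down by one, and digit 0 is the remainder modulo
    2. *)
Lemma eq_binary_digits n a b : (a < 2 ^ n)%N -> (b < 2 ^ n)%N ->
  (forall j, (j < n)%N -> odd (a %/ 2 ^ j) = odd (b %/ 2 ^ j)) -> a = b.
Proof.
elim: n a b => [|n IHn] a b; first by rewrite expn0; case: a b => [|?] [|?].
rewrite expnS => an bn dig.
rewrite (divn_eq a 2) (divn_eq b 2) !modn2; congr (_ * 2 + _)%N.
  apply: IHn => [||j jn]; rewrite ?ltn_divLR 1?mulnC // -?divnMA -?expnS.
  exact: dig.
by have := dig 0%N isT; rewrite expn0 !divn1 => ->.
Qed.

Definition digit_set n (a : nat) : {set 'I_n} :=
  [set j : 'I_n | odd (a %/ 2 ^ j)].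

(** Uniqueness of binary expansions gives injectivity; both sides have [2 ^ n] elements. *)
Lemma digit_set_bij n : bijective (fun a : 'I_(2 ^ n) => digit_set n a).
Proof.
apply: inj_card_bij => [a b /setP ab|]; last first.
  by rewrite -cardsT -powersetT card_powerset cardsT !card_ord.
apply/val_inj/(eq_binary_digits (ltn_ord a) (ltn_ord b)) => j jn.
by have := ab (Ordinal jn); rewrite !inE.
Qed.

Section GMOI.
Variables (R : realType) (H : completeNormedModType R[i]) (zeta : nat).
Local Notation C := (Cplx R).
Variable beta : 'rV[C]_zeta.+1 -> C.
Implicit Types (X : 'I_zeta.+1 -> decomposed_op H) (Y : 'I_zeta -> operator H).

(** Limits are assumed for each single [K]; splitting the finite sums first allows these limits to
    be added. *)
Lemma riemann_sum_sum (P : pred {set 'I_zeta.+1}) X Y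
    (t : forall p, tpart (spectrum (X p))) (v : H) :
  riemann_sum beta P Y t v = \sum_(K | P K) riemann_sum beta (pred1 K) Y t v.
Proof.
rewrite /riemann_sum exchange_big /=; apply: eq_bigr => j _.
by apply: eq_bigr => K _; rewrite /integrand big_pred1_eq.
Qed.

Lemma gmoi_part_sum (P : pred {set 'I_zeta.+1}) X Y
    (T : {set 'I_zeta.+1} -> H -> H) :
  (forall K, P K -> is_gmoi_part beta (pred1 K) X Y (T K)) ->
  is_gmoi_part beta P X Y (fun v => \sum_(K | P K) T K v).
Proof.
move=> TP v; under eq_cvg do rewrite riemann_sum_sum.
have ? := multi_refinement_filter (fun p => spectrum (X p)).
apply: cvg_big => [|K /TP]; first exact: add_continuous.
exact.
Qed.

(* [xi_array X i p] is not convertible to an entry over [X p], and the type of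
   the partitions depends on the underlying operators: hence the hypothesis
   [entry_op \o e = X] as an equation between families, to be eliminated. *)
Lemma gmoi_eq (e : 'I_zeta.+1 -> entry H) X Y (P : pred {set 'I_zeta.+1})
    (T : H -> H) :
    (fun p => entry_op (e p)) = X ->
    (forall K : {set 'I_zeta.+1},
       [forall p, entry_allows (e p) (p \in K)] = P K) ->
  is_gmoi_part beta P X Y T -> gmoi beta e Y = T.
Proof.
move=> eX eP; rewrite /gmoi (funext eP); case: _ / eX => TP.
apply/funext => v; apply: cvg_lim (TP v); first exact: norm_hausdorff.
exact: multi_refinement_filter.
Qed.

End GMOI.

Theorem proposition1 (R : realType) (H : completeNormedModType R[i])
    (dot : {dot H for Num.conj}) (hdot : hilbert_norm dot)
    (zeta : nat) (hzeta : (1 <= zeta)%N)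
    (X : 'I_zeta.+1 -> decomposed_op H) (Y : 'I_zeta -> operator H)
    (beta : 'rV[Cplx R]_zeta.+1 -> Cplx R)
    (hT : gmoi_defined beta X Y) :
  gmoi beta (fun p => Whole (X p)) Y =
  \sum_(1 <= i < (2 ^ zeta.+1).+1) gmoi beta (xi_array X i) Y.
Proof.
have [_ /choice[T TP]] := hT.
(* [Whole] entries exclude no subset, hence [predT]. *)
rewrite (@gmoi_eq _ _ _ _ _ X _ predT (fun v => \sum_K T K v)) //; last 2 first.
- by move=> K; apply/forallP.
- by apply: gmoi_part_sum => K _; apply: TP.
(* After the shift to a 0-based index, the digits read by [xi_array] are those of [i] itself. *)
rewrite big_add1 big_mkord; under eq_bigr => i _.
  rewrite (@gmoi_eq _ _ _ _ _ X _ (pred1 (digit_set zeta.+1 i))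
             (T (digit_set zeta.+1 i))); first over.
  - by apply/funext => p; rewrite /xi_array; case: ifP.
  - move=> K; rewrite /= eq_sym.
    (* A digit 1 at [p] gives a [PartN] entry and forces [p] into [K]; a digit 0 forces it out. *)
    apply/forallP/eqP => [iK|<- p]; last first.
      by rewrite inE /xi_array subn1 /=; case: ifP.
    apply/setP => p; have := iK p; rewrite inE /xi_array subn1 /=.
    by case: ifP => _ /=; [move=> -> | move/negbTE->].
  - exact: TP.
rewrite fct_sumE; apply/funext => v.
(* Each subset is the digit set of exactly one [i]. *)
exact: (reindex _ (onW_bij _ (digit_set_bij zeta.+1))).
Qed.
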